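(* Let $k\ge 1$ and $n_1,\dots,n_k\ge 1$. For each $1\le i\le k$ let $A_i,B_i,C_i\in M_{n_i}(\mathbb{C})$ be positive semi-definite matrices and let $d_i$ be a generalized matrix function on $M_{n_i}(\mathbb{C})$. For $X_i\in M_{n_i}(\mathbb{C})$ put $d(X_1,\dots,X_k)=d_1(X_1)\cdots d_k(X_k)$. Then for every $r\in\{1\}\cup[2,\infty)$, $$\begin{aligned}&d(A_1+B_1+C_1,\dots,A_k+B_k+C_k)^r+d(A_1,\dots,A_k)^r+d(B_1,\dots,B_k)^r+d(C_1,\dots,C_k)^r\\ &\ \ge\ d(A_1+B_1,\dots,A_k+B_k)^r+d(A_1+C_1,\dots,A_k+C_k)^r+d(B_1+C_1,\dots,B_k+C_k)^r.\end{aligned}$$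
   Context: $M_n(\mathbb{C})$ denotes the $n\times n$ complex matrices; positive semi-definite matrices are Hermitian. A generalized matrix function on $M_n(\mathbb{C})$ is a function of the form $d_\chi^G(A)=\sum_{\sigma\in G}\chi(\sigma)\prod_{i=1}^n a_{i\,\sigma(i)}$ for $A=(a_{ij})$, where $G$ is a subgroup of the symmetric group $S_n$ and $\chi$ is a linear (degree-one complex) character of $G$. Different $d_i$ may come from different groups and characters. On positive semi-definite matrices the values of a generalized matrix function are nonnegative real numbers, so real powers make sense. *)

(* Defs.v *)
From mathcomp Require Import all_boot all_order all_algebra all_fingroup.
From mathcomp Require Import mxrepresentation complex reals exp.

Set Implicit Arguments.
Unset Strict Implicit.
Unset Printing Implicit Defensive.

Import Order.TTheory GRing.Theory Num.Theory.

Local Open Scope ring_scope.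
Local Open Scope sesquilinear_scope.
Local Open Scope complex_scope.

Definition psdmx (R : realType) (n : nat) (A : 'M[R[i]]_n) : Prop :=
  A \is hermsymmx /\
  forall v : 'cV[R[i]]_n, 0 <= (v ^t* *m A *m v) 0 0.

(* A linear character of [G] is the trace of a degree-one representation of
   [G] over [R[i]]; [mathcomp.character.character] is specific to [algC]. *)
Definition linear_character (R : realType) (n : nat) (G : {group 'S_n})
    (chi : 'S_n -> R[i]) : Prop :=
  exists rho : mx_representation R[i] G 1,
    {in G, forall s, chi s = \tr (rho s)}.

Definition gen_mx_fun (R : realType) (n : nat) (G : {group 'S_n})
    (chi : 'S_n -> R[i]) (A : 'M[R[i]]_n) : R[i] :=
  \sum_(s in G) chi s * \prod_(i < n) A i (s i).

Definition is_gen_mx_fun (R : realType) (n : nat) (d : 'M[R[i]]_n -> R[i]) :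
    Prop :=
  exists (G : {group 'S_n}) (chi : 'S_n -> R[i]),
    linear_character G chi /\ d =1 gen_mx_fun G chi.

(* [X] is a [k]-tuple of square matrices whose sizes [n i] may differ. *)
Definition prod_mx_fun (R : realType) (k : nat) (n : 'I_k -> nat)
    (d : forall i, 'M[R[i]]_(n i) -> R[i]) (X : forall i, 'M[R[i]]_(n i)) :
    R[i] :=
  \prod_(i < k) d i (X i).

(* Real power of a complex number [z] that is a nonnegative real: [complex.Re]
   then only transports [z] to [R]. *)
Definition real_power (R : realType) (z : R[i]) (r : R) : R :=
  complex.Re z `^ r.

(* Main.v *)
Require Import Defs.
From mathcomp Require Import classical_sets.
From mathcomp Require Import all_boot all_order all_algebra all_fingroup.
From mathcomp Require Import ring lra.
From mathcomp Require Import mxrepresentation complex reals exp.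
From mathcomp Require Import topology normedtype derive realfun convex hoelder.
From mathcomp Require Import interval_inference.

(** With [X_1, .., X_n] positive semidefinite, [sum_(s, t in G) conj (chi s) *
    chi t * prod_j X_j (s j) (t j)] is the quadratic form of the tensor product
    of the [X_j] at a fixed vector, hence nonnegative.  When all [X_j] equal
    [A] it is [#|G|] times the generalized matrix function at [A].  Expanding
    it multilinearly at [A + B + C] writes [d (sum_(l in S) X_l)], as a function
    of the set [S] of summands, as a sum over [T \subset S] of nonnegative
    masses, a property that is stable under products.  This reduces the theorem
    to an inequality between nonnegative reals, which follows from the convexity
    of [x ^ r] and of its derivative. *)

Set Implicit Arguments.
Unset Strict Implicit.
Unset Printing Implicit Defensive.

Import Order.TTheory GRing.Theory Num.Theory numFieldNormedType.Exports.

Local Open Scope ring_scope.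
Local Open Scope sesquilinear_scope.
Local Open Scope complex_scope.

(** * Inequalities for real powers *)

Lemma convex_powR_combination (R : realType) (p x y l : R) :
  1 <= p -> 0 <= x -> 0 <= y -> 0 <= l <= 1 ->
  (l * x + (1 - l) * y) `^ p <= l * x `^ p + (1 - l) * y `^ p.
Proof.
move=> p1 x0 y0 /andP[l0 l1].
have := convex_powR p1 (Itv01 l0 l1) (x := x) (y := y).
rewrite !classical_sets.in_setE /= !in_itv /= x0 y0 => /(_ isT isT).
by rewrite !convRE.
Qed.

(** Both [u + h] and [v] lie between [u] and [v + h], as convex combinations with swapped weights;
    adding the two convexity inequalities gives the claim. *)
Lemma powR_increment_ndecr (R : realType) (p u v h : R) :
  1 <= p -> 0 <= u -> u <= v -> 0 <= h ->
  (u + h) `^ p - u `^ p <= (v + h) `^ p - v `^ p.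
Proof.
move=> p1 u0 uv h0.
have [e0|e0] := eqVneq (v + h - u) 0.
  have -> : h = 0 by lra.
  by rewrite !addr0 !subrr.
have d0 : 0 < v + h - u by rewrite lt_neqAle eq_sym e0; lra.
pose l := h / (v + h - u).
have l01 : 0 <= l <= 1.
  by rewrite divr_ge0 ?(ltW d0)//= ler_pdivrMr// mul1r; lra.
have l01' : 0 <= 1 - l <= 1 by lra.
have vh0 : 0 <= v + h by lra.
have := convex_powR_combination p1 vh0 u0 l01.
have := convex_powR_combination p1 vh0 u0 l01'.
have -> : l * (v + h) + (1 - l) * u = u + h by rewrite /l; field.
have -> : (1 - l) * (v + h) + (1 - (1 - l)) * u = v by rewrite /l; field.
lra.
Qed.

Lemma powR_third_difference_ge0 (R : realType) (r a b c : R) :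
  2 <= r -> 0 <= a -> 0 <= b -> 0 <= c ->
  (a + b) `^ r + (a + c) `^ r + (b + c) `^ r <=
  (a + b + c) `^ r + a `^ r + b `^ r + c `^ r.
Proof.
move=> r2 a0 b0 c0; have rn0 : r != 0 by lra.
have [->|an0] := eqVneq a 0.
  by rewrite !add0r powR0//; lra.
have [->|bn0] := eqVneq b 0; first by rewrite !addr0 !add0r powR0//; lra.
have [->|cn0] := eqVneq c 0; first by rewrite !addr0 powR0//; lra.
have {a0 an0}a0 : 0 < a by rewrite lt_neqAle eq_sym an0.
have {b0 bn0}b0 : 0 < b by rewrite lt_neqAle eq_sym bn0.
have {c0 cn0}c0 : 0 < c by rewrite lt_neqAle eq_sym cn0.
pose g (t : R) := (t + (b + c)) `^ r - (t + b) `^ r - (t + c) `^ r + t `^ r.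
have cont (f : R -> R) (x : R) :
    derivable f x 1 -> (f y @[y --> x] --> f x)%classic.
  by move=> /derivable1_diffP /differentiable_continuous.
have dpow (h t : R) : 0 < t + h ->
    is_derive t 1 (fun x : R => (x + h) `^ r) (r * (t + h) `^ (r - 1)).
  move=> th; rewrite -[_ * _]mulr1.
  exact: (@is_derive1_comp R (@powR R ^~ r) (shift h) t _ _
    (is_derive1_powR r th) (is_derive_shift t 1 h)).
have dg (t : R) : 0 < t -> is_derive t 1 g
   (r * (t + (b + c)) `^ (r - 1) - r * (t + b) `^ (r - 1)
     - r * (t + c) `^ (r - 1) + r * t `^ (r - 1)).
  move=> t0; apply: is_deriveD; last exact: is_derive1_powR.
  by apply: is_deriveB; [apply: is_deriveB|]; apply: dpow; lra.
have g0a : g 0 <= g a.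
  apply: (@ger0_derive1_le_cc R g 0 a).
  - by move=> x; rewrite in_itv /= => /andP[x0 _]; case: (dg x x0).
  - move=> x; rewrite in_itv /= => /andP[x0 _].
    have dx := dg _ x0; rewrite derive1E derive_val.
    have r1 : 1 <= r - 1 by lra.
    have cx0 : 0 <= x by lra.
    have cxb : x <= x + b by lra.
    have := powR_increment_ndecr r1 cx0 cxb (ltW c0).
    rewrite -addrA -subr_ge0 => /(mulr_ge0 (_ : 0 <= r)); lra.
  - apply: derivable_oo_LRcontinuous_within; split.
    + by move=> x; rewrite in_itv /= => /andP[x0 _]; case: (dg x x0).
    (* At the endpoint [0] the shifted powers are differentiable since their base [h] is positive;
       the unshifted one has base [0] and needs a separate limit. *)
    + have cpow (h : R) : 0 < h ->
          ((x + h) `^ r @[x --> 0^'+] --> (0 + h) `^ r)%classic.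
        move=> h0; apply: cvg_at_right_filter.
        apply: (cont (fun x : R => (x + h) `^ r)).
        by case: (dpow h 0); rewrite ?add0r.
      apply: cvgD; last by rewrite powR0//; apply: powR_cvg0; lra.
      by apply: cvgB; [apply: cvgB|]; apply: cpow; lra.
    + apply: cvg_at_left_filter; apply: cont.
      by case: (dg a a0).
  - by rewrite in_itv /= lexx ltW.
  - by rewrite in_itv /= lexx ltW.
  - exact: ltW.
move: g0a; rewrite /g !add0r powR0// !addrA; lra.
Qed.

(* Each summand [p], [q], [s] can be moved from the smaller argument to the
   larger one by convexity, which reduces to [p = q = s = t = 0]. *)
Lemma powR_hornich_hlawka (R : realType) (r a b c p q s t : R) :
  r = 1 \/ 2 <= r -> 0 <= a -> 0 <= b -> 0 <= c ->
  0 <= p -> 0 <= q -> 0 <= s -> 0 <= t ->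
  (a + b + p) `^ r + (a + c + q) `^ r + (b + c + s) `^ r <=
  (a + b + c + p + q + s + t) `^ r + a `^ r + b `^ r + c `^ r.
Proof.
case=> [->|r2] a0 b0 c0 p0 q0 s0 t0; first by rewrite !powRr1; lra.
have r1 : 1 <= r by lra.
have h0 := powR_third_difference_ge0 r2 a0 b0 c0.
have h1 : (a + b + p) `^ r - (a + b) `^ r
    <= (a + b + c + p) `^ r - (a + b + c) `^ r.
  by apply: powR_increment_ndecr; lra.
have h2 : (a + c + q) `^ r - (a + c) `^ r
    <= (a + b + c + p + q) `^ r - (a + b + c + p) `^ r.
  by apply: powR_increment_ndecr; lra.
have h3 : (b + c + s) `^ r - (b + c) `^ r
    <= (a + b + c + p + q + s) `^ r - (a + b + c + p + q) `^ r.
  by apply: powR_increment_ndecr; lra.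
have h4 : (a + b + c + p + q + s) `^ r <= (a + b + c + p + q + s + t) `^ r.
  by apply: ge0_ler_powR; rewrite ?nnegrE; lra.
lra.
Qed.

(** * Positive forms and generalized matrix functions *)

Lemma psdmx_spectral (R : realType) (n : nat) (A : 'M[R[i]]_n) : psdmx A ->
  let D := spectral_diag A in let P := spectralmx A in
  (forall l, 0 <= D 0 l) /\
  (forall a b, A a b = \sum_l D 0 l * ((P l a)^* * P l b)).
Proof.
move=> [hA psdA] D P.
have uP : P \is unitarymx by exact: spectral_unitarymx.
have PPt : P *m P^t* = 1%:M by exact/unitarymxP.
have eA : A = P^t* *m diag_mx D *m P.
  by have /hermitian_normalmx /orthomx_spectralP := hA; rewrite invmx_unitary.
split=> [l|a b].
  (* This vector is the [l]-th eigenvector, at which the quadratic form takes the value [D 0 l]. *)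
  have := psdA (P^t* *m delta_mx l 0).
  rewrite trmx_mul map_mxM trmxCK eA !mulmxA.
  rewrite -[_ *m P *m P^t*]mulmxA PPt mulmx1 -[_ *m P *m P^t*]mulmxA PPt mulmx1.
  rewrite trmx_delta map_delta_mx -rowE -colE !mxE.
  by rewrite eqxx mulr1n.
rewrite {1}eA mxE; apply: eq_bigr => l _.
by rewrite mul_mx_diag !mxE mulrA [D 0 l * _]mulrC.
Qed.

(** Diagonalizing each [X j] and expanding over the choices [h] of one eigenvalue per [j] turns the
    form into a sum of squared moduli of [Z h], weighted by products of eigenvalues. *)
Lemma psdmx_prod_form_ge0 (R : realType) (n : nat) (I J : finType)
    (X : J -> 'M[R[i]]_n) (P : pred I) (phi : I -> J -> 'I_n) (w : I -> R[i]) :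
  (forall j, psdmx (X j)) ->
  0 <= \sum_(s | P s) \sum_(t | P t)
         (w s)^* * w t * \prod_j X j (phi s j) (phi t j).
Proof.
move=> hX.
pose D j := spectral_diag (X j); pose U j := spectralmx (X j).
pose Z (h : {ffun J -> 'I_n}) :=
  \sum_(t | P t) w t * \prod_j U j (h j) (phi t j).
have -> : \sum_(s | P s) \sum_(t | P t)
    (w s)^* * w t * \prod_j X j (phi s j) (phi t j)
  = \sum_(h : {ffun J -> 'I_n}) (\prod_j D j 0 (h j)) * ((Z h)^* * Z h).
  have eX s t : \prod_j X j (phi s j) (phi t j) = \sum_(h : {ffun J -> 'I_n})
      (\prod_j D j 0 (h j)) * ((\prod_j U j (h j) (phi s j))^*
        * \prod_j U j (h j) (phi t j)).
    under eq_bigr => j _ do rewrite (psdmx_spectral (hX j)).2.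
    rewrite bigA_distr_bigA; apply: eq_bigr => h _.
    by rewrite !big_split /= rmorph_prod.
  under eq_bigr => s _ do under eq_bigr => t _ do rewrite eX mulr_sumr.
  under eq_bigr => s _ do rewrite exchange_big.
  rewrite exchange_big; apply: eq_bigr => h _.
  rewrite rmorph_sum mulr_suml mulr_sumr; apply: eq_bigr => s _.
  rewrite !mulr_sumr; apply: eq_bigr => t _.
  by rewrite rmorphM /= mulrCA; congr (_ * _); rewrite mulrACA.
apply: sumr_ge0 => h _; apply: mulr_ge0.
  by apply: prodr_ge0 => j _; apply: (psdmx_spectral (hX j)).1.
by rewrite mulrC mul_conjC_ge0.
Qed.

Lemma linear_characterJM (R : realType) (n : nat) (G : {group 'S_n})
    (chi : 'S_n -> R[i]) : linear_character G chi ->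
  {in G &, forall s t, (chi s)^* * chi t = chi (s^-1 * t)%g}.
Proof.
move=> [rho hchi].
have chiM : {in G &, {morph chi : s t / (s * t)%g >-> s * t}}.
  move=> s t sG tG; rewrite !hchi ?groupM// repr_mxM// /mxtrace !big_ord1.
  by rewrite mxE big_ord1.
have chi1 : chi 1%g = 1 by rewrite hchi// repr_mx1 mxtrace1.
have chiX s m : s \in G -> chi (s ^+ m)%g = chi s ^+ m.
  move=> sG; elim: m => [|m IHm]; first by rewrite expg0 chi1.
  by rewrite expgS chiM ?groupX// IHm exprS.
move=> s t sG tG; rewrite chiM ?groupV//; congr (_ * _).
have normchi : `|chi s| = 1.
  (* [chi s] is a root of unity, so its conjugate is its inverse. *)
  apply/eqP; rewrite -(@pexpr_eq1 _ _ #[s]%g)//.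
  by rewrite -normrX -chiX// expg_order chi1 normr1.
have chin0 : chi s != 0 by rewrite -normr_eq0 normchi oner_eq0.
apply: (mulfI chin0); rewrite -chiM ?groupV// mulgV chi1.
by rewrite -normCK normchi expr1n.
Qed.

(** For each fixed [s], the inner sum over [t] is already [gen_mx_fun G chi A]: replace the
    summation variable by [s^-1 * t] and the row index by [s j]. *)
Lemma gen_mx_fun_form (R : realType) (n : nat) (G : {group 'S_n})
    (chi : 'S_n -> R[i]) (A : 'M[R[i]]_n) : linear_character G chi ->
  gen_mx_fun G chi A = #|G|%:R^-1 *
    \sum_(s in G) \sum_(t in G) (chi s)^* * chi t * \prod_j A (s j) (t j).
Proof.
move=> hchi; apply: (canRL (mulKf _)).
  by rewrite pnatr_eq0 -lt0n cardG_gt0.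
rewrite mulr_natl -sumr_const; apply: eq_bigr => s sG.
rewrite /gen_mx_fun (reindex_inj (mulgI s^-1%g)) /=.
apply: eq_big => [t|t]; first by rewrite groupMl ?groupV.
rewrite groupMl ?groupV// => tG; rewrite (linear_characterJM hchi)//.
congr (_ * _).
rewrite (reindex_inj (@perm_inj _ s)) /=; apply: eq_bigr => j _.
by rewrite permM permK.
Qed.

(** * Totally monotone set functions *)

(* The Moebius transform of [F] over the subset lattice is nonnegative. *)
Definition totally_monotone (K : numDomainType) (L : finType)
    (F : {set L} -> K) : Prop :=
  exists2 m : {set L} -> K, (forall T, 0 <= m T) &
    forall S, F S = \sum_(T : {set L} | T \subset S) m T.

Lemma totally_monotone1 (K : numDomainType) (L : finType) :
  totally_monotone (fun _ : {set L} => 1 : K).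
Proof.
exists (fun T => (T == set0)%:R) => [T|S]; first exact: ler0n.
rewrite (bigD1 set0) ?sub0set//= eqxx big1 ?addr0// => T /andP[_ /negPf->].
by [].
Qed.

(** Two sets both lie in [S] exactly when their union does, so the masses of the product are those
    of the factors convolved along unions. *)
Lemma totally_monotoneM (K : numDomainType) (L : finType)
    (F H : {set L} -> K) : totally_monotone F -> totally_monotone H ->
  totally_monotone (fun S => F S * H S).
Proof.
move=> [m m0 eF] [p p0 eH].
exists (fun U => \sum_(V : {set L} * {set L} | V.1 :|: V.2 == U) m V.1 * p V.2).
  by move=> U; apply: sumr_ge0 => V _; apply: mulr_ge0.
move=> S; rewrite eF eH big_distrlr pair_big_dep /=.
rewrite (partition_big (fun V => V.1 :|: V.2) (fun U => U \subset S)) /=.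
  apply: eq_bigr => U US; apply: eq_bigl => V.
  by rewrite andb_idl// => /eqP VU; rewrite -subUset VU.
by move=> V; rewrite -subUset.
Qed.

Lemma totally_monotone_prod (K : numDomainType) (L I : finType)
    (F : I -> {set L} -> K) : (forall i, totally_monotone (F i)) ->
  totally_monotone (fun S => \prod_i F i S).
Proof.
move=> hF; rewrite unlock; elim: (index_enum I) => [|i s IHs] /=.
  exact: totally_monotone1.
exact: totally_monotoneM.
Qed.

Lemma totally_monotone_gen_mx_fun (R : realType) (n : nat) (L : finType)
    (d : 'M[R[i]]_n -> R[i]) (X : L -> 'M[R[i]]_n) :
  is_gen_mx_fun d -> (forall l, psdmx (X l)) ->
  totally_monotone (fun S : {set L} => d (\sum_(l in S) X l)).
Proof.
move=> [G [chi [hchi ed]]] hX.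
pose q (f : {ffun 'I_n -> L}) := \sum_(s in G) \sum_(t in G)
  (chi s)^* * chi t * \prod_j X (f j) (s j) (t j).
pose im (f : {ffun 'I_n -> L}) := [set f j | j : 'I_n].
(* In the multilinear expansion [f] picks one summand for each factor [j]; the mass of [T] collects
   the [f] that use exactly the summands in [T]. *)
exists (fun T => #|G|%:R^-1 * \sum_(f | im f == T) q f) => [T|S].
  rewrite mulr_ge0 ?invr_ge0 ?ler0n//; apply: sumr_ge0 => f _.
  exact: psdmx_prod_form_ge0.
rewrite ed (gen_mx_fun_form _ hchi) -mulr_sumr; congr (_ * _).
have eS s t : \prod_j (\sum_(l in S) X l) (s j) (t j) =
    \sum_(f : {ffun 'I_n -> L} | im f \subset S)
      \prod_j X (f j) (s j) (t j).
  under eq_bigr => j _ do rewrite summxE.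
  rewrite bigA_distr_big; apply: eq_bigl => f.
  apply/ffun_onP/subsetP => [fS l /imsetP[j _ ->] //|fS j].
  by apply: fS; apply: imset_f.
under eq_bigr => s _ do under eq_bigr => t _ do rewrite eS mulr_sumr.
under eq_bigr => s _ do rewrite exchange_big.
rewrite exchange_big /=.
rewrite (partition_big im (fun T => T \subset S)) //=.
apply: eq_bigr => T TS; apply: eq_bigl => f.
by rewrite andb_idl// => /eqP->.
Qed.

Lemma gen_mx_fun0 (R : realType) (n : nat) (d : 'M[R[i]]_n -> R[i]) :
  (0 < n)%N -> is_gen_mx_fun d -> d 0 = 0.
Proof.
case: n d => // n d _ [G [chi [_ ->]]]; apply: big1 => s _.
by rewrite big_ord_recl mxE mul0r mulr0.
Qed.

Lemma sum_subsetU1 (V : nmodType) (L : finType) (m : {set L} -> V) (x : L)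
    (S : {set L}) : x \notin S ->
  \sum_(T : {set L} | T \subset x |: S) m T =
  \sum_(T : {set L} | T \subset S) (m T + m (x |: T)).
Proof.
move=> xS; rewrite big_split /= (bigID (fun T : {set L} => x \in T)) /= addrC.
congr (_ + _).
  apply: eq_bigl => T; rewrite -subDset.
  apply/andP/idP => [[TS xT]|TS].
    by rewrite (setDidPl _) // disjoint_sym disjoints1 in TS *.
  split; first exact: subset_trans (subsetDl _ _) TS.
  by apply: contra xS; exact: (subsetP TS).
rewrite (reindex_onto (fun T => x |: T) (fun T => T :\ x)) /=; last first.
  by move=> T /andP[_ xT]; rewrite setD1K.
apply: eq_bigl => T; rewrite setU11 andbT.
apply/andP/idP => [[TS /eqP <-]|TS]; first by rewrite subDset.
split; first exact: setUS.
by rewrite setU1K//; apply: contra xS; exact: (subsetP TS).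
Qed.

Lemma totally_monotone3 (K : numDomainType) (L : finType) (F : {set L} -> K)
    (x y z : L) : x != y -> x != z -> y != z ->
  totally_monotone F -> F set0 = 0 ->
  exists p q s t : K, [/\ 0 <= p, 0 <= q, 0 <= s & 0 <= t] /\
    [/\ 0 <= F [set x], 0 <= F [set y] & 0 <= F [set z]] /\
    [/\ F [set x; y] = F [set x] + F [set y] + p,
        F [set x; z] = F [set x] + F [set z] + q,
        F [set y; z] = F [set y] + F [set z] + s &
        F [set x; y; z] = F [set x] + F [set y] + F [set z] + p + q + s + t].
Proof.
move=> xy xz yz [m m0 eF].
have F0 : F set0 = m set0.
  by rewrite eF (big_pred1 set0) // => T; rewrite subset0.
have F1 u : F [set u] = m set0 + m [set u].
  rewrite -(setU0 [set u]) eF sum_subsetU1 ?inE// (big_pred1 set0) // => T.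
  by rewrite subset0.
have F2 u v : u != v ->
    F [set u; v] = m set0 + m [set u] + m [set v] + m [set u; v].
  move=> uv; rewrite eF sum_subsetU1 ?inE// big_split /=.
  rewrite -(setU0 [set v]) !sum_subsetU1 ?inE//.
  rewrite !(big_pred1 set0) //=; try by move=> T; rewrite subset0.
  by rewrite !setU0 !addrA [m set0 + m [set v] + _]addrAC.
move=> F00; have m00 : m set0 = 0 by rewrite -F0.
(* The masses of the pairs and of the triple; [F set0 = 0] removes the mass of the empty set, so
   singleton masses are the values of [F]. *)
exists (m [set x; y]), (m [set x; z]), (m [set y; z]), (m [set x; y; z]).
split; first by split.
split; first by rewrite !F1 m00 !add0r.
split; try by rewrite F2// !F1 m00 !add0r.
(* The subsets avoiding [x] add up to [F [set y; z]]; only those containing [x] remain to be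
   listed. *)
rewrite -setUA eF sum_subsetU1 ?inE ?negb_or ?xy// big_split /= -!eF.
rewrite F2// !F1 m00.
rewrite sum_subsetU1 ?inE// -(setU0 [set z]) !sum_subsetU1 ?inE//.
rewrite !(big_pred1 set0) //=; try by move=> T; rewrite subset0.
by rewrite !setU0 !add0r !setUA; ring.
Qed.

(** * The inequality for products *)

Theorem mainTheorem2 (R : realType) (k : nat) (hk : (1 <= k)%N)
    (n : 'I_k -> nat) (hn : forall i, (1 <= n i)%N)
    (A B C : forall i : 'I_k, 'M[R[i]]_(n i))
    (hA : forall i, psdmx (A i)) (hB : forall i, psdmx (B i))
    (hC : forall i, psdmx (C i))
    (d_ : forall i : 'I_k, 'M[R[i]]_(n i) -> R[i])
    (hd : forall i, is_gen_mx_fun (d_ i))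
    (r : R) (hr : r = 1 \/ 2 <= r) :
  let d := prod_mx_fun d_ in
  real_power (d (fun i => A i + B i)) r +
  real_power (d (fun i => A i + C i)) r +
  real_power (d (fun i => B i + C i)) r <=
  real_power (d (fun i => A i + B i + C i)) r +
  real_power (d A) r + real_power (d B) r + real_power (d C) r.
Proof.
pose X (l : 'I_3) i := tnth [tuple A i; B i; C i] l.
pose F (S : {set 'I_3}) := prod_mx_fun d_ (fun i => \sum_(l in S) X l i).
have hF : totally_monotone F.
  apply: (totally_monotone_prod
    (F := fun i (S : {set 'I_3}) => d_ i (\sum_(l in S) X l i))) => i.
  apply: totally_monotone_gen_mx_fun => // l; rewrite /X.
  by case: l => [[|[|[|]]]].
(* As [k >= 1], the product has a factor, and that factor vanishes at the zero matrix because its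
   size is positive. *)
have F0 : F set0 = 0.
  rewrite /F /prod_mx_fun (bigD1 (Ordinal hk)) //= big_set0.
  by rewrite gen_mx_fun0 ?mul0r.
pose o0 : 'I_3 := Ordinal (isT : 0 < 3)%N.
pose o1 : 'I_3 := Ordinal (isT : 1 < 3)%N.
pose o2 : 'I_3 := Ordinal (isT : 2 < 3)%N.
have ext (Y Z : forall i, 'M[R[i]]_(n i)) :
  (forall i, Y i = Z i) -> prod_mx_fun d_ Y = prod_mx_fun d_ Z.
  by move=> eYZ; apply: eq_bigr => i _; rewrite eYZ.
have F1 : F [set o0] = prod_mx_fun d_ A by apply: ext => i; rewrite big_set1.
have F2 : F [set o1] = prod_mx_fun d_ B by apply: ext => i; rewrite big_set1.
have F3 : F [set o2] = prod_mx_fun d_ C by apply: ext => i; rewrite big_set1.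
have F12 : F [set o0; o1] = prod_mx_fun d_ (fun i => A i + B i).
  by apply: ext => i; rewrite big_setU1 ?inE//= big_set1.
have F13 : F [set o0; o2] = prod_mx_fun d_ (fun i => A i + C i).
  by apply: ext => i; rewrite big_setU1 ?inE//= big_set1.
have F23 : F [set o1; o2] = prod_mx_fun d_ (fun i => B i + C i).
  by apply: ext => i; rewrite big_setU1 ?inE//= big_set1.
have F123 : F [set o0; o1; o2] = prod_mx_fun d_ (fun i => A i + B i + C i).
  apply: ext => i; rewrite -setUA !big_setU1 ?inE//= big_set1.
  by rewrite addrA.
have [p [q [s [t []]]]] :=
  @totally_monotone3 _ _ _ o0 o1 o2 isT isT isT hF F0.
rewrite F1 F2 F3 F12 F13 F23 F123 /real_power.
move=> [p0 q0 s0 t0] [[a0 b0 c0] [-> -> -> ->]] /=.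
(* Since [complex.Re] is additive and preserves nonnegativity, the decomposition into masses passes
   from [R[i]] to [R]. *)
have re0 (z : R[i]) : 0 <= z -> 0 <= complex.Re z by rewrite lecE => /andP[].
by rewrite !raddfD /=; apply: powR_hornich_hlawka; rewrite ?re0.
Qed.
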